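(* Let $K\ge 2$ be an integer and let $\mathrm{LY}(\sigma_K)\subset\Sigma_K\times\Sigma_K$ be the set of all Li--Yorke pairs of $(\Sigma_K,\sigma_K)$. Then $\dim_H \mathrm{LY}(\sigma_K)=2$ and $\mathscr{H}^2(\mathrm{LY}(\sigma_K))=1$.
   Context: $\Sigma_K=\{0,\dots,K-1\}^{\mathbb{N}}$ with $\mathbb{N}=\{0,1,2,\dots\}$, endowed with the metric $\rho(x,y)=K^{-\delta(x,y)}$, where $\delta(x,y)=\inf\{i\ge 0:x_i\ne y_i\}$ ($\rho(x,x)=0$). The shift map $\sigma_K:\Sigma_K\to\Sigma_K$ is $(\sigma_K(x))_i=x_{i+1}$. The product $\Sigma_K\times\Sigma_K$ carries the sup metric. For a continuous self-map $f$ of a compact metric space $(X,\rho)$, a pair $(x,y)\in X\times X$ is a Li--Yorke pair if $\liminf_{i\to\infty}\rho(f^i(x),f^i(y))=0$ and $\limsup_{i\to\infty}\rho(f^i(x),f^i(y))>0$. $\mathscr{H}^s$ is the $s$-dimensional Hausdorff measure with no normalizing constant: $\mathscr{H}^s(A)=\lim_{\delta\to0^+}\inf\sum_i|A_i|^s$, the infimum over countable covers $(A_i)$ of $A$ with $\sup_i|A_i|<\delta$, where $|\cdot|$ denotes diameter; $\dim_H$ is Hausdorff dimension. *)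

(* Defs.v *)
From HB Require Import structures.
From mathcomp Require Import all_boot all_order all_algebra.
From mathcomp Require Import all_classical all_reals all_analysis.

Set Implicit Arguments.
Unset Strict Implicit.
Unset Printing Implicit Defensive.

Import Order.TTheory GRing.Theory Num.Theory.

Local Open Scope classical_set_scope.
Local Open Scope ring_scope.

Section prod_metric.
Context {R : realType} {U V : metricType R}.

Let dist (p q : U * V) : R := Num.max (mdist p.1 q.1) (mdist p.2 q.2).

Let dist_ge0 p q : 0 <= dist p q.
Proof. by rewrite /dist le_max mdist_ge0. Qed.

Let dist_positivity p q : dist p q = 0 -> p = q.
Proof.
move=> d0; have := lexx (dist p q); rewrite {2}d0 /dist ge_max => /andP[d1 d2].
case: p q d1 d2 {d0} => [x y] [x' y'] /= d1 d2.
by congr pair; apply: mdist_positivity; apply/eqP; rewrite eq_le mdist_ge0 andbT.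
Qed.

Let ballEdist p d : ball p d = [set q | dist p q < d].
Proof.
apply/seteqP; split => q; rewrite /ball/= /prod_ball /dist /= gt_max.
  by move=> [/=]; rewrite !ballEmdist /= => -> ->.
by move=> /andP[? ?]; split; rewrite ballEmdist.
Qed.

HB.instance Definition _ := PseudoMetric_isMetric.Build R (U * V)%type
  dist_ge0 dist_positivity ballEdist.

End prod_metric.

(* The parameter [R] is the field in which distances take their values; it
   only serves the inference of the metric structure. *)
Definition full_shift (R : realType) (K : nat) : Type := nat -> 'I_K.

HB.instance Definition _ R K := Choice.copy (full_shift R K) (nat -> 'I_K).

Section full_shift_metric.
Context {R : realType} {K : nat}.
Implicit Types x y z : full_shift R K.

(* The junk value 0 for [x = y], where the infimum is infinite, is never used
   by [rho]. *)
Definition delta x y : nat :=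
  if pselect (exists i, x i != y i) is left xy then ex_minn xy else 0%N.

Definition rho x y : R := if x == y then 0 else K%:R ^- delta x y.

Lemma neq_full_shift x y : x != y -> exists i, x i != y i.
Proof.
move=> /eqP xy; apply: contrapT => /forallNP h; apply: xy; apply/funext => i.
by apply/eqP; have /negP := h i; rewrite negbK.
Qed.

Lemma deltaP x y : x != y ->
  x (delta x y) != y (delta x y) /\ forall i, (i < delta x y)%N -> x i = y i.
Proof.
move=> /neq_full_shift xy; rewrite /delta; case: pselect => // {}xy.
case: ex_minnP => m xym min; split => // i; apply: contraTeq => xyi.
by rewrite -leqNgt; exact: min.
Qed.

Let rhoxx x : rho x x = 0.
Proof. by rewrite /rho eqxx. Qed.

Let K_gt0 x : 0 < K%:R :> R.
Proof. by rewrite ltr0n (leq_ltn_trans _ (ltn_ord (x 0%N))). Qed.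

Let rho_ge0 x y : 0 <= rho x y.
Proof. by rewrite /rho; case: ifP => // _; rewrite invr_ge0 exprn_ge0. Qed.

Let rho_positivity x y : rho x y = 0 -> x = y.
Proof.
rewrite /rho; case: eqP => // _ /eqP.
by rewrite invr_eq0 expf_eq0 gt_eqF ?andbF// (K_gt0 x).
Qed.

Let rho_sym x y : rho x y = rho y x.
Proof.
have [->//|xy] := eqVneq x y.
have yx : y != x by rewrite eq_sym.
rewrite /rho (negbTE xy) (negbTE yx).
have [/eqP h1 m1] := deltaP xy; have [/eqP h2 m2] := deltaP yx.
suff -> : delta x y = delta y x by [].
apply/eqP; rewrite eqn_leq (leqNgt (delta x y)) (leqNgt (delta y x)).
apply/andP; split; apply/negP.
  by move=> /m1 /esym.
by move=> /m2 /esym.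
Qed.

Let rho_triangle y x z : rho x z <= rho x y + rho y z.
Proof.
have [->|xy] := eqVneq x y; first by rewrite rhoxx add0r.
have [->|yz] := eqVneq y z; first by rewrite rhoxx addr0.
have [->|xz] := eqVneq x z; first by rewrite rhoxx addr_ge0.
have Kmono m n : (m <= n)%N -> K%:R ^- n <= K%:R ^- m :> R.
  move=> mn; rewrite lef_pV2 ?posrE ?exprn_gt0 ?(K_gt0 x)//.
  by rewrite ler_weXn2l// ler1n -(ltr0n R) (K_gt0 x).
have : (delta x y <= delta x z)%N || (delta y z <= delta x z)%N.
  rewrite (leqNgt (delta x y)) (leqNgt (delta y z)) -negb_and.
  have [/eqP xzd _] := deltaP xz; apply/negP => /andP[].
  by move=> /(proj2 (deltaP xy)) xyE /(proj2 (deltaP yz)) yzE; rewrite xyE in xzd.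
have := rho_ge0 x y; have := rho_ge0 y z.
rewrite /rho (negbTE xy) (negbTE yz) (negbTE xz) => p q /orP[|] /Kmono h.
  by apply: (le_trans h); rewrite lerDl.
by apply: (le_trans h); rewrite lerDr.
Qed.

HB.instance Definition _ := isMetric.Build R (full_shift R K)
  rhoxx rho_positivity rho_sym rho_triangle.

Definition shift_map x : full_shift R K := fun i => x i.+1.

End full_shift_metric.

Section Li_Yorke.
Context {R : realType} {X : metricType R}.
Local Open Scope ereal_scope.

Definition Li_Yorke_pair (f : X -> X) (x y : X) : Prop :=
  limn_einf (fun i => (mdist (iter i f x) (iter i f y))%:E) = 0 /\
  0 < limn_esup (fun i => (mdist (iter i f x) (iter i f y))%:E).

Definition Li_Yorke_pairs (f : X -> X) : set (X * X) :=
  [set p | Li_Yorke_pair f p.1 p.2].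

End Li_Yorke.

Section Hausdorff_measure.
Context {R : realType} {X : metricType R}.
Implicit Types (A : set X) (s d : R).
Local Open Scope ereal_scope.

(* The maximum with 0 only affects the empty set, whose supremum is -oo. *)
Definition diam A : \bar R :=
  maxe 0 (ereal_sup [set (mdist p.1 p.2)%:E | p in A `*` A]).

(* |A|^s, where the empty set counts for 0 even if [s = 0]: sequences of sets
   thus account for finite covers as well, by padding with empty sets. *)
Definition diam_pow s A : \bar R := if A == set0 then 0 else diam A `^ s.

Definition covers_lt d A : set (nat -> set X) :=
  [set C | A `<=` \bigcup_i C i /\ ereal_sup (range (diam \o C)) < d%:E].

Definition Hausdorff_premeasure s d A : \bar R :=
  ereal_inf [set \sum_(0 <= i <oo) diam_pow s (C i) | C in covers_lt d A].

Definition Hausdorff_measure s A : \bar R :=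
  lim (Hausdorff_premeasure s d A @[d --> 0^'+]).

Definition Hausdorff_dim A : \bar R :=
  ereal_inf [set s%:E | s in [set s | (0 <= s)%R /\ Hausdorff_measure s A = 0]].

End Hausdorff_measure.

(* Main.v *)
(* Upper bounds come from covering by the K^(2n) cylinders of level n, of
   diameter K^-n.  For the lower bounds it is enough, diameters being at most 1,
   that every countable cover of the Li-Yorke pairs satisfies
   1 <= sum_i |C_i|^2.  Otherwise the C_i lie in cylinders whose total measure,
   for the uniform product measure on sequences of pairs of letters, is smaller
   than 1.  Words are then extended greedily, keeping the conditional total
   measure below 1: it can first be made so small that any prescribed block may
   be appended.  Appending agreeing blocks of length k followed by a
   disagreement, for every k, produces a Li-Yorke pair outside all C_i. *)

Require Import Defs.
From mathcomp Require Import all_boot all_order all_algebra.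
From mathcomp Require Import all_classical all_reals all_analysis lra.

Set Implicit Arguments.
Unset Strict Implicit.
Unset Printing Implicit Defensive.

Import Order.TTheory GRing.Theory Num.Theory.
Import numFieldNormedType.Exports.

Local Open Scope classical_set_scope.
Local Open Scope ring_scope.

(** * Masses of cylinders and greedy extension of words *)

Section cond_mass.
Context {R : realType} {T : finType}.
Hypothesis T_gt0 : (0 < #|T|)%N.
Implicit Types u w v : seq T.
Local Notation Q := (#|T|%:R : R).

Let Q_gt0 : 0 < Q. Proof. by rewrite ltr0n. Qed.

(* The condition says that one of [u] and [w] is a prefix of the other, so this
   is the conditional probability of the cylinder [u] given the cylinder [w]
   under the uniform product measure. *)
Definition cond_mass u w : R :=
  if take (size u) w == take (size w) u then Q ^- (size u - size w) else 0.

Lemma cond_mass_ge0 u w : 0 <= cond_mass u w.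
Proof. by rewrite /cond_mass; case: ifP => // _; rewrite invr_ge0 exprn_ge0 ?ltW. Qed.

Lemma cond_mass_nil u : cond_mass u [::] = Q ^- size u.
Proof. by rewrite /cond_mass take0 eqxx subn0. Qed.

Lemma cond_mass_prefix u w : prefix u w -> cond_mass u w = 1.
Proof.
move=> /[dup] /size_prefix uw; rewrite prefixE /cond_mass => /eqP ->.
by rewrite take_oversize// eqxx (eqP uw) expr0 invr1.
Qed.

Lemma cond_mass_eq0 u w : (size u <= size w)%N -> cond_mass u w < 1 ->
  cond_mass u w = 0.
Proof.
by move=> /eqP uw; rewrite /cond_mass; case: ifP => // _; rewrite uw expr0 invr1 ltxx.
Qed.

(** Total probability over the next letter. If [u] is no longer than [w], the new letter changes
    nothing; otherwise at most one letter contributes, the one that continues [u], and it gains a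
    factor [Q]. *)
Lemma sum_cond_mass_rcons u w :
  \sum_(a : T) cond_mass u (rcons w a) = Q * cond_mass u w.
Proof.
rewrite /cond_mass; have [uw|wu] := leqP (size u) (size w).
  under eq_bigr => a _.
    rewrite size_rcons -cats1 takel_cat// [take _.+1 _]take_oversize ?leqW//.
    rewrite (eqP (leqW uw)) expr0 invr1.
    over.
  rewrite sumr_const [take (size w) u]take_oversize// (eqP uw) expr0 invr1.
  by case: ifP => _; rewrite ?mulr1 ?mulr0 ?mul0rn.
have [a0 _] : exists a0 : T, a0 \in T by apply/card_gt0P.
under eq_bigr => a _.
  rewrite take_oversize ?size_rcons// (take_nth a0)// eqseq_rcons.
  over.
rewrite [take (size u) w]take_oversize ?(ltnW wu)//.
case: eqP => _ /=; last by rewrite big1// mulr0.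
rewrite -big_mkcond/= big_pred1_eq -(subnSK wu) exprS invfM mulrA divff ?mul1r//.
by rewrite gt_eqF.
Qed.

(** One letter at a time: each term of the nonnegative sum in [sum_cond_mass_rcons] is at most the
    whole sum. *)
Lemma cond_mass_cat u w v : cond_mass u (w ++ v) <= Q ^+ size v * cond_mass u w.
Proof.
elim/last_ind: v => [|v a IH]; first by rewrite cats0 mul1r.
rewrite -rcons_cat size_rcons exprS -mulrA.
apply: le_trans (ler_wpM2l (ltW Q_gt0) IH).
rewrite -sum_cond_mass_rcons (bigD1 a)//= lerDl.
by apply: sumr_ge0 => b _; exact: cond_mass_ge0.
Qed.

Local Open Scope ereal_scope.
Variable u : nat -> seq T.
Implicit Type c : nat -> R.

Definition weighted_mass c w : \bar R :=
  \sum_(0 <= i <oo) (c i * cond_mass (u i) w)%:E.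

Let term_ge0 c w i : (forall i, 0 <= c i)%R -> 0 <= (c i * cond_mass (u i) w)%:E.
Proof. by move=> c0; rewrite lee_fin mulr_ge0// cond_mass_ge0. Qed.

(** Pigeonhole: the mean over the letters of the extended masses is the mass at [w], so they cannot
    all be at least 1. *)
Lemma weighted_mass_rcons c w : (forall i, 0 <= c i)%R ->
  weighted_mass c w < 1 -> exists a, weighted_mass c (rcons w a) < 1.
Proof.
move=> c0 w1; apply: contrapT => /forallNP h.
have : \sum_(a : T) weighted_mass c (rcons w a) = Q%:E * weighted_mass c w.
  rewrite /weighted_mass -nneseries_sum; last by move=> *; exact: term_ge0.
  rewrite -nneseriesZl; last by move=> *; exact: term_ge0.
  apply: eq_eseriesr => i _; rewrite sumEFin -mulr_sumr sum_cond_mass_rcons.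
  by rewrite -EFinM mulrCA.
apply/eqP; rewrite gt_eqF//; apply: (@lt_le_trans _ _ Q%:E).
  by rewrite -[X in _ < X]mule1 lte_pmul2l.
have -> : Q%:E = \sum_(a : T) (1 : \bar R) by rewrite sumEFin sumr_const.
by apply: lee_sum => a _; have /negP := h a; rewrite -leNgt.
Qed.

Lemma weighted_mass_cat n c w : (forall i, 0 <= c i)%R ->
  weighted_mass c w < 1 ->
  exists v, size v = n /\ weighted_mass c (w ++ v) < 1.
Proof.
move=> c0; elim: n w => [|n IH] w w1; first by exists [::]; rewrite cats0.
have [a /IH[v [<- v1]]] := weighted_mass_rcons c0 w1.
by exists (a :: v); rewrite -cat_rcons.
Qed.

Lemma term_le_weighted_mass c w i : (forall i, 0 <= c i)%R ->
  (c i * cond_mass (u i) w)%:E <= weighted_mass c w.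
Proof.
move=> c0; apply: le_trans (@nneseries_lim_ge _ _ xpredT 0%N i.+1 _); last first.
  by move=> *; exact: term_ge0.
by rewrite big_nat_recr//= leeDr// sume_ge0// => *; exact: term_ge0.
Qed.

Definition mass := weighted_mass (fun=> 1%R).

(* The series is reweighted by a large constant on its tail.  The new total is
   still smaller than 1, hence so it is along a long extension of [w]; there
   the finitely many remaining terms, being 0 or 1, must vanish. *)
Lemma mass_steer w v : mass w < 1 ->
  exists2 w', prefix w w' & mass (w' ++ v) < 1.
Proof.
(* By [cond_mass_cat], appending [v] multiplies every term by at most [C], so [C] is the weight to
   give to the tail. *)
move=> w1; pose C := (Q ^+ size v)%R.
have C1 : (1 <= C)%R by rewrite exprn_ege1// ler1n.
have C0 : (0 < C)%R by exact: lt_le_trans C1.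
have mE k : \sum_(k <= i <oo) (1 * cond_mass (u i) w)%:E =
            \sum_(k <= i <oo) (cond_mass (u i) w)%:E.
  by apply: eq_eseriesr => i _; rewrite mul1r.
have tg k : 0 <= \sum_(k <= i <oo) (cond_mass (u i) w)%:E.
  by apply: nneseries_ge0 => *; rewrite lee_fin cond_mass_ge0.
have mfin : mass w \is a fin_num.
  by rewrite ge0_fin_numE ?(lt_trans w1) ?ltry// /mass /weighted_mass mE.
have [N tailN] : exists N,
    \sum_(N <= i <oo) (cond_mass (u i) w)%:E < ((1 - fine (mass w)) / C)%:E.
  have := @nneseries_tail_cvg R (fun i => (cond_mass (u i) w)%:E) xpredT.
  rewrite -mE => /(_ (lt_trans w1 (ltry _))).
  move=> /(_ (fun k _ => cond_mass_ge0 _ _)) cv.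
  have d0 : (0 < (1 - fine (mass w)) / C)%R.
    by rewrite divr_gt0// subr_gt0 -lte_fin fineK.
  have /fine_cvgP[fn /cvgr0Pnorm_lt /(_ _ d0)] := cv.
  move=> lt; near \oo => N.
  exists N; rewrite -[X in X < _]fineK; last by near: N.
  by rewrite lte_fin (le_lt_trans (ler_norm _))//; near: N.
pose c i : R := if (i < N)%N then 1%R else C.
have c0 i : (0 <= c i)%R by rewrite /c; case: ifP => _//; exact: ltW.
have cw : weighted_mass c w < 1.
  rewrite /weighted_mass (@nneseries_split _ _ 0 N)//; last first.
    by move=> *; exact: term_ge0.
  rewrite add0n.
  have -> : \sum_(N <= i <oo) (c i * cond_mass (u i) w)%:E =
      C%:E * \sum_(N <= i <oo) (cond_mass (u i) w)%:E.
    rewrite -nneseriesZl; last by move=> *; rewrite lee_fin cond_mass_ge0.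
    rewrite [LHS]eseries_cond [RHS]eseries_cond.
    by apply: eq_eseriesr => i /= Ni; rewrite /c ltnNge Ni.
  apply: (@le_lt_trans _ _
      (mass w + C%:E * \sum_(N <= i <oo) (cond_mass (u i) w)%:E)).
    rewrite leeD2r//.
    have -> : \sum_(0 <= i < N) (c i * cond_mass (u i) w)%:E =
        \sum_(0 <= i < N) (1 * cond_mass (u i) w)%:E.
      by rewrite !big_mkord; apply: eq_bigr => i _; rewrite /c ltn_ord.
    by apply: nneseries_lim_ge => *; exact: term_ge0.
  rewrite -(fineK mfin) -lteBrDl// -EFinD -lte_pdivlMl//.
  by rewrite -EFinM mulrC.
pose n := (\max_(i < N) size (u i))%N.
have [x [xn x1]] := weighted_mass_cat n c0 cw.
exists (w ++ x); first exact: prefix_prefix.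
apply: le_lt_trans (x1); apply: lee_nneseries => [*|i _]; first exact: term_ge0.
rewrite lee_fin mul1r; apply: le_trans (cond_mass_cat _ _ _) _.
rewrite /c; case: ifPn => [iN|//]; rewrite cond_mass_eq0 ?mulr0//.
  rewrite size_cat xn (leq_trans _ (leq_addl _ _))// /n.
  exact: (@leq_bigmax _ (fun i : 'I_N => size (u i)) (Ordinal iN)).
rewrite -lte_fin; apply: le_lt_trans (x1).
have := term_le_weighted_mass (w ++ x) i c0.
by rewrite {1}/c iN mul1r.
Unshelve. all: by end_near. Qed.


Lemma prefix_mkseq (z : nat -> T) m n : (m <= n)%N ->
  prefix (mkseq z m) (mkseq z n).
Proof. by move=> mn; rewrite prefixE size_mkseq -map_take take_iota (minn_idPl mn). Qed.

(** A word of mass below 1 has no [u i] as a prefix, since that term alone would be 1. Steering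
    before each block [v k] keeps the mass below 1 along a chain of prefixes, whose limit is [z]. *)
Lemma avoid_cylinders (v : nat -> seq T) :
  (forall k, (0 < size (v k))%N) -> mass [::] < 1 ->
  exists z : nat -> T,
    (forall i, mkseq z (size (u i)) <> u i) /\
    (forall k, exists2 n, (k <= n)%N &
       mkseq (fun i => z (n + i)%N) (size (v k)) = v k).
Proof.
move=> v0 m0; have [t0 _] : exists t0 : T, t0 \in T by apply/card_gt0P.
have /choice[f fP] : forall p : nat * seq T, exists w', mass p.2 < 1 ->
    prefix p.2 w' /\ mass (w' ++ v p.1) < 1.
  (* Here [[::]] is a dummy output for words of mass at least 1; by [W1] below, no [W k] is such a
     word. *)
  move=> [k w]; have [w1|w1] := pselect (mass w < 1); last by exists [::].
  by have [w' ? ?] := mass_steer (v k) w1; exists w'.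
pose W := nat_rect (fun=> seq T) [::] (fun k w => f (k, w) ++ v k).
have W1 k : mass (W k) < 1 by elim: k => [//|k /(fP (k, _))[]].
have WfS k : prefix (W k) (f (k, W k)) by have [] := fP (k, W k) (W1 k).
have WS k : prefix (W k) (W k.+1).
  by apply: prefix_trans (WfS k) _; exact: prefix_prefix.
(* The blocks being nonempty, the words grow: every letter of [z] gets determined, and [v k] occurs
   at a position no smaller than [k]. *)
have kW k : (k <= size (W k))%N.
  elim: k => // k IH; rewrite /= size_cat -addn1 leq_add//.
  by apply: leq_trans IH _; exact: size_prefix.
have Wmn m n : (m <= n)%N -> prefix (W m) (W n).
  move=> /subnK <-; elim: (n - m)%N => [|j IH]; first exact: prefix_refl.
  by rewrite addSn; exact: prefix_trans IH (WS _).
have nthW m n i : (m <= n)%N -> (i < size (W m))%N ->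
    nth t0 (W m) i = nth t0 (W n) i.
  by move=> /Wmn/prefixP[s ->] im; rewrite nth_cat im.
pose z i := nth t0 (W i.+1) i.
have zW k i : (i < size (W k))%N -> nth t0 (W k) i = z i.
  move=> ik; have [ki|/ltnW ki] := leqP k i.+1; first exact: nthW.
  by rewrite /z (nthW _ _ _ ki)// kW.
have WE k : mkseq z (size (W k)) = W k.
  apply: (@eq_from_nth _ t0); rewrite size_mkseq// => i ik.
  by rewrite nth_mkseq// zW.
exists z; split => [i zu|k].
  have : prefix (u i) (W (size (u i))) by rewrite -{1}zu -WE prefix_mkseq.
  move=> /cond_mass_prefix ui1.
  have := term_le_weighted_mass (W (size (u i))) i (fun=> ler01).
  by rewrite ui1 mul1r leNgt W1.
exists (size (f (k, W k))); first by rewrite (leq_trans (kW k))// size_prefix.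
apply: (@eq_from_nth _ t0); rewrite size_mkseq// => i iv; rewrite nth_mkseq//.
by rewrite -(zW k.+1) /= ?size_cat ?ltn_add2l// nth_cat ltnNge leq_addr addKn.
Qed.

End cond_mass.

(** * Generalities on diameters and Hausdorff measures *)

Section Hausdorff_measure_theory.
Context {R : realType} {X : metricType R}.
Implicit Types (A : set X) (s r : R).
Local Open Scope ereal_scope.

Lemma mdist_le_diam A x y : A x -> A y -> (mdist x y)%:E <= diam A.
Proof.
move=> Ax Ay; rewrite /diam le_max; apply/orP; right.
by apply: ereal_sup_ubound; exists (x, y).
Qed.

Lemma diam_ge0 A : 0 <= diam A.
Proof. by rewrite /diam le_max lexx. Qed.

Lemma diam_pow_ge0 s A : 0 <= diam_pow s A.
Proof. by rewrite /diam_pow; case: ifP => // _; exact: poweR_ge0. Qed.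

Lemma diam_pow_le s A r : (0 <= s)%R -> diam A <= r%:E ->
  diam_pow s A <= (r `^ s)%:E.
Proof.
move=> s0 Ar; rewrite /diam_pow; case: ifP => _; first by rewrite lee_fin powR_ge0.
rewrite -poweR_EFin gt0_ler_poweR ?in_itv//= ?leey ?andbT ?diam_ge0//.
exact: le_trans (diam_ge0 A) Ar.
Qed.

Lemma Hausdorff_premeasure_antitone s A :
  {homo (fun d => Hausdorff_premeasure s d A) : d d' / (d <= d')%R >-> d' <= d}.
Proof.
move=> d d' dd'; apply: ereal_inf_le_tmp => _ [C [AC Cd] <-]; exists C => //.
by split => //; rewrite (lt_le_trans Cd)// lee_fin.
Qed.

(** The premeasure is monotone in [d], so the limit exists and inherits the bound. *)
Lemma Hausdorff_measure_ge s A (r : \bar R) :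
  (forall d, (0 < d)%R -> r <= Hausdorff_premeasure s d A) ->
  r <= Hausdorff_measure s A.
Proof.
move=> rA; apply: lime_ge.
  apply: nonincreasing_at_right_is_cvge; near=> x => d d' _ _.
  exact: Hausdorff_premeasure_antitone.
by near=> d; apply: rA; near: d; exact: nbhs_right_gt.
Unshelve. all: by end_near. Qed.

Lemma Hausdorff_measure_cst s A (r : \bar R) :
  (forall d, (0 < d)%R -> Hausdorff_premeasure s d A = r) ->
  Hausdorff_measure s A = r.
Proof.
move=> rA; apply: lim_near_cst => //.
by near=> d; apply: rA; near: d; exact: nbhs_right_gt.
Unshelve. all: by end_near. Qed.

End Hausdorff_measure_theory.

(** * The metric on pairs of sequences, and Li-Yorke pairs built from blocks *)

Section full_shift_theory.
Context {R : realType} {K : nat}.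
Hypothesis K_ge2 : (2 <= K)%N.
Local Notation X := (full_shift R K).
Local Notation T := ('I_K * 'I_K)%type.
Implicit Types (p q : X * X) (C : set (X * X)) (u : seq T).

Let K_gt0 : 0 < K%:R :> R. Proof. by rewrite ltr0n ltnW. Qed.

Lemma mdist_le_expn (x y : X) n : (forall i, (i < n)%N -> x i = y i) ->
  mdist x y <= K%:R ^- n.
Proof.
move=> xy; have -> : mdist x y = rho x y by [].
rewrite /rho; case: ifPn => [_|/deltaP[/eqP xyd _]].
  by rewrite invr_ge0 exprn_ge0 ?ltW.
rewrite lef_pV2 ?posrE ?exprn_gt0// ler_weXn2l// ?ler1n ?(ltnW K_ge2)//.
by rewrite leqNgt; apply/negP => /xy.
Qed.

Lemma mdist_ge_expn (x y : X) n : x n <> y n -> K%:R ^- n <= mdist x y.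
Proof.
move=> xyn; have -> : mdist x y = rho x y by [].
rewrite /rho; case: ifPn => [/eqP xy|/deltaP[_ xy]]; first by rewrite xy in xyn.
rewrite lef_pV2 ?posrE ?exprn_gt0// ler_weXn2l// ?ler1n ?(ltnW K_ge2)//.
by rewrite leqNgt; apply/negP => /xy.
Qed.

(** Identifies the product with sequences over K^2 letters: the sup metric becomes K^-n, with n the
    first index of disagreement, so that small sets sit in cylinders. *)
Definition pair_seq p : nat -> T := fun i => (p.1 i, p.2 i).

Lemma mdist_pair_le_expn p q n :
  (forall i, (i < n)%N -> pair_seq p i = pair_seq q i) ->
  mdist p q <= K%:R ^- n.
Proof.
move=> pq; have -> : mdist p q = Num.max (mdist p.1 q.1) (mdist p.2 q.2) by [].
by rewrite ge_max !mdist_le_expn// => i /pq[].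
Qed.

Lemma mdist_pair_ge_expn p q n :
  pair_seq p n <> pair_seq q n -> K%:R ^- n <= mdist p q.
Proof.
move=> pq; have -> : mdist p q = Num.max (mdist p.1 q.1) (mdist p.2 q.2) by [].
rewrite le_max; have [pq1|pq1] := pselect (p.1 n = q.1 n); last first.
  by rewrite mdist_ge_expn.
apply/orP; right; apply: mdist_ge_expn => pq2; apply: pq.
by rewrite /pair_seq pq1 pq2.
Qed.

Lemma near_expn_lt (e : R) : 0 < e -> \forall n \near \oo, K%:R ^- n < e :> R.
Proof.
move=> e0; have /cvgr0Pnorm_lt /(_ _ e0) :
    (K%:R^-1 : R) ^+ n @[n --> \oo] --> (0 : R).
  by apply: cvg_expr; rewrite ger0_norm ?invr_ge0 ?ltW// invf_lt1// ltr1n.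
by apply: filterS => n; rewrite exprVn; apply: le_lt_trans; exact: ler_norm.
Qed.

Lemma iter_shift_map (x : X) n i : iter n (@shift_map R K) x i = x (n + i)%N.
Proof.
elim: n i => [//|n IH] i; rewrite iterS.
by rewrite -[LHS]/(iter n (@shift_map R K) x i.+1) IH addSnnS.
Qed.

(** The block at [n] makes the distance at most K^-k at time [n] and at least 1 at time [n + k]; as
    [n] is at least [k], both happen arbitrarily late. *)
Lemma Li_Yorke_of_blocks p (a b : 'I_K) : a != b ->
  (forall k, exists2 n, (k <= n)%N &
     mkseq (fun i => pair_seq p (n + i)%N) k.+1 =
       rcons (nseq k (a, a)) (a, b)) ->
  Li_Yorke_pairs (@shift_map R K) p.
Proof.
move=> /eqP ab blk.
pose d i := mdist (iter i (@shift_map R K) p.1) (iter i (@shift_map R K) p.2).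
have {}blk k : exists2 n, (k <= n)%N & d n <= K%:R ^- k /\ 1 <= d (n + k)%N.
  have [n kn E] := blk k; exists n => //.
  have zE i : (i <= k)%N ->
      pair_seq p (n + i)%N = nth (a, a) (rcons (nseq k (a, a)) (a, b)) i.
    by move=> ik; rewrite -E nth_mkseq.
  split.
    apply: mdist_le_expn => i ik; rewrite !iter_shift_map.
    by have := zE i (ltnW ik); rewrite nth_rcons size_nseq ik nth_nseq ik => -[-> ->].
  rewrite -[leLHS]invr1 -(expr0 K%:R); apply: mdist_ge_expn.
  rewrite !iter_shift_map addn0.
  by have := zE k (leqnn k); rewrite nth_rcons size_nseq ltnn eqxx => -[-> ->].
have d0 i : 0 <= d i by exact: mdist_ge0.
split; last first.
  rewrite /= -/(d _); apply: (@lt_le_trans _ _ 1%E) => //.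
  apply: le_ereal_inf_tmp => _ [V [N _ NV] <-].
  have [n Nn [_ dn]] := blk N.
  apply: (@le_trans _ _ (d (n + N)%N)%:E); first by rewrite lee_fin.
  by apply: ereal_sup_ubound; exists (n + N)%N => //; apply: NV => /=; rewrite leq_addl.
(* [limn_einf] is minus the upper limit of the opposite sequence, an infimum of suprema over
   neighbourhoods of infinity. Nonnegativity uses the whole of the naturals as neighbourhood; the
   other bound uses the late agreeing blocks. *)
rewrite /=; apply/eqP; rewrite eq_le; apply/andP; split; last first.
  rewrite /limn_einf leeNr oppe0.
  apply: (@le_trans _ _ (ereal_sup (range (fun i => - (d i)%:E)%E))).
    by apply: ereal_inf_lbound; exists setT => //; exact: filterT.
  by apply: ge_ereal_sup => _ [i _ <-]; rewrite leeNl oppe0 lee_fin.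
rewrite /limn_einf leeNl oppe0.
apply: le_ereal_inf_tmp => _ [V [N _ NV] <-].
apply/lee_addgt0Pr => e e0.
near \oo => k; have [n kn [dn _]] := blk k.
rewrite -leeBlDr// add0e; apply: (@le_trans _ _ (- (d n)%:E)%E).
  rewrite leeN2 lee_fin (le_trans dn)// ltW//.
  by near: k; exact: near_expn_lt.
apply: ereal_sup_ubound; exists n => //; apply: NV => /=.
by apply: leq_trans kn; near: k; exact: nbhs_infty_ge.
Unshelve. all: by end_near. Qed.

(** * Diameters against masses of cylinders, and the lower bound for covers *)

Local Open Scope ereal_scope.

Lemma diam_le_expn C n :
  (forall p q, C p -> C q -> forall i, (i < n)%N -> pair_seq p i = pair_seq q i) ->
  diam C <= (K%:R ^- n)%:E.
Proof.
move=> Cn; rewrite /diam ge_max lee_fin invr_ge0 exprn_ge0 ?(ltW K_gt0)//=.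
apply: ge_ereal_sup => _ [[p q] [/= Cp Cq] <-].
by rewrite lee_fin mdist_pair_le_expn//; exact: Cn.
Qed.

Lemma diam_pow_antitone s t C : (0 <= s)%R -> (s <= t)%R ->
  diam_pow t C <= diam_pow s C.
Proof.
move=> s0 st; rewrite /diam_pow; case: ifP => // _.
have := diam_ge0 C; have : diam C <= 1.
  by rewrite -[1]/(1%R%:E) -(invr1 R) -(expr0 K%:R); apply: diam_le_expn.
case: (diam C) => [r| |]//; rewrite !lee_fin => r1.
rewrite le_eqVlt => /orP[/eqP<-|r0]; last by rewrite ger_powR// r0.
(* Zero diameter: its power is 0 if [t] is nonzero, while [t = 0] forces [s = 0]. *)
have [t0|t0] := eqVneq t 0%R; last by rewrite powR0// powR_ge0.
suff -> : s = t by [].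
by apply/eqP; rewrite eq_le st t0.
Qed.

(** If [n] is the first index where two points of [C] disagree, then [C] has diameter at least K^-n
    and lies in a cylinder of mass K^(-2n). If there is none, [C] has at most one point and a long
    word of mass at most [e] is taken. *)
Lemma cover_by_cylinder C (e : R) : (0 < e)%R ->
  exists u, (forall p, C p -> mkseq (pair_seq p) (size u) = u) /\
    (#|{: T}|%:R ^- size u)%:E <= diam_pow 2 C + e%:E.
Proof.
move=> e0; have cardT n : (#|{: T}|%:R ^- n : R)%R = ((K%:R ^- n) ^+ 2)%R.
  by rewrite card_prod card_ord natrM exprMn invfM expr2.
pose D n := exists p q, [/\ C p, C q & pair_seq p n <> pair_seq q n].
have agree n : (forall i, (i < n)%N -> ~ D i) ->
    exists2 u, size u = n & forall p, C p -> mkseq (pair_seq p) n = u.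
  move=> nD; have [-> | /set0P[c Cc]] := eqVneq C set0.
    have a : 'I_K := Ordinal K_ge2.
    by exists (nseq n (a, a)); rewrite ?size_nseq.
  exists (mkseq (pair_seq c) n); rewrite ?size_mkseq// => p Cp.
  apply/eq_in_map => i; rewrite mem_iota add0n => /nD Di.
  by apply: contrapT => pc; apply: Di; exists p, c.
have [|/forallNP nD] := pselect (exists n, `[< D n >]).
  move=> /ex_minnP[n /asboolP[p [q [Cp Cq pq]]] nmin].
  have [i ni|u un Cu] := agree n.
    by move=> /asboolP /nmin; rewrite leqNgt ni.
  exists u; rewrite un; split => //; apply: lee_paddr; first by rewrite lee_fin ltW.
  rewrite cardT /diam_pow ifF; last by apply/eqP => C0; rewrite C0 in Cp.
  have n0 : (0 <= K%:R ^- n :> R)%R by rewrite invr_ge0 exprn_ge0// ltW.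
  rewrite -powR_mulrn// -poweR_EFin gt0_ler_poweR ?in_itv//= ?leey ?andbT//.
  - exact: diam_ge0.
  - apply: le_trans (mdist_le_diam Cp Cq).
    by rewrite lee_fin mdist_pair_ge_expn.
near \oo => n; have [i ni|u un Cu] := agree n; first by move=> /asboolP; exact: nD.
exists u; rewrite un; split => //; apply: lee_paddl; first exact: diam_pow_ge0.
rewrite lee_fin cardT expr2; apply: (@le_trans _ _ (K%:R ^- n)); last first.
  by apply/ltW; near: n; exact: near_expn_lt.
rewrite ler_piMl// ?invr_ge0 ?exprn_ge0 ?(ltW K_gt0)//.
by rewrite invf_le1 ?exprn_gt0// exprn_ege1// ler1n ltnW.
Unshelve. all: by end_near. Qed.

Lemma sum_diam_pow_ge1 (C : nat -> set (X * X)) :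
  Li_Yorke_pairs (@shift_map R K) `<=` \bigcup_i C i ->
  1 <= \sum_(0 <= i <oo) diam_pow 2 (C i).
Proof.
move=> LYC; rewrite leNgt; apply/negP => sum1.
set S := \sum_(0 <= i <oo) _ in sum1.
have S0 : 0 <= S by apply: nneseries_ge0 => *; exact: diam_pow_ge0.
have Sfin : S \is a fin_num by rewrite ge0_fin_numE// (lt_trans sum1) ?ltry.
(* The slack [e] pays for enlarging the [C i] to cylinders, at a cost of e / 2^(i+1) each. *)
have [e e0 Se] : exists2 e : R, (0 < e)%R & S + e%:E < 1.
  exists ((1 - fine S) / 2)%R.
    by rewrite divr_gt0// subr_gt0 -lte_fin fineK.
  rewrite -(fineK Sfin) -EFinD lte_fin.
  have : (fine S < 1)%R by rewrite -lte_fin fineK.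
  lra.
have /choice[u uP] : forall i, exists u,
    (forall p, C i p -> mkseq (pair_seq p) (size u) = u) /\
    (#|{: T}|%:R ^- size u)%:E <= diam_pow 2 (C i) + (e / (2 ^ i.+1)%:R)%:E.
  by move=> i; apply: cover_by_cylinder; rewrite divr_gt0// ltr0n expn_gt0.
have T0 : (0 < #|{: T}|)%N by rewrite card_prod card_ord muln_gt0 (ltnW K_ge2).
have mu1 : mass (R := R) u [::] < 1.
  apply: le_lt_trans Se; apply: le_trans (epsilon_trick xpredT _ (ltW e0)).
    apply: lee_nneseries => i _; first by rewrite mul1r lee_fin cond_mass_ge0.
    by rewrite mul1r cond_mass_nil; have [] := uP i.
  by move=> i; exact: diam_pow_ge0.
pose a : 'I_K := Ordinal (ltnW K_ge2); pose b : 'I_K := Ordinal K_ge2.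
have v0 k : (0 < size (rcons (nseq k (a, a)) (a, b)))%N by rewrite size_rcons.
have [z [zu zv]] := avoid_cylinders T0 v0 mu1.
pose p : X * X := (fun i => (z i).1, fun i => (z i).2).
have pz : pair_seq p = z by apply/funext => i; rewrite /pair_seq /=; case: (z i).
have [|i _ Cip] := LYC p.
  apply: (@Li_Yorke_of_blocks p a b) => // k; have [n kn zn] := zv k.
  by exists n => //; rewrite pz; move: zn; rewrite size_rcons size_nseq.
by apply: (zu i); rewrite -pz; apply: (uP i).1.
Qed.

(** * Bounds on the Hausdorff premeasures *)

Lemma Hausdorff_premeasure_le (A : set (X * X)) (s d : R) n : (0 <= s)%R ->
  (K%:R ^- n < d)%R ->
  Hausdorff_premeasure s d A <= ((K%:R ^+ n) ^+ 2 * (K%:R ^- n) `^ s)%:E.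
Proof.
move=> s0 nd.
(* The cylinders of level [n] are numbered by [enum_rank]; from [N] on, the sets are empty and
   [diam_pow] counts them for 0. *)
pose C i := [set p : X * X | exists2 t : n.-tuple T,
  enum_rank t = i :> nat & mkseq (pair_seq p) n = t].
pose N := #|{: n.-tuple T}|.
have Cdiam i : diam (C i) <= (K%:R ^- n)%:E.
  apply: diam_le_expn => p q [t <- pt] [t' + qt] j jn.
  move=> /ord_inj/enum_rank_inj tt; rewrite tt -pt in qt.
  by rewrite -(nth_mkseq (pair_seq p j) _ jn) -qt nth_mkseq.
have C0 i : (N <= i)%N -> diam_pow s (C i) = 0.
  move=> Ni; rewrite /diam_pow ifT//; apply/eqP/seteqP; split => // p [t ti _].
  by have := ltn_ord (enum_rank t); rewrite ti ltnNge Ni.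
have Ccov : covers_lt d A C.
  split; last first.
    apply: (@le_lt_trans _ _ (K%:R ^- n)%:E); last by rewrite lte_fin.
    by apply: ge_ereal_sup => _ [i _ <-]; exact: Cdiam.
  move=> p _; have sz : size (mkseq (pair_seq p) n) == n by rewrite size_mkseq.
  by exists (enum_rank (Tuple sz)) => //; exists (Tuple sz).
apply: (@le_trans _ _ (\sum_(0 <= i <oo) diam_pow s (C i))).
  by apply: ereal_inf_lbound; exists C.
rewrite (@nneseries_split _ _ 0 N); last by move=> *; exact: diam_pow_ge0.
rewrite add0n (eseries0 (fun i Ni _ => C0 i Ni)) adde0.
apply: (@le_trans _ _ (\sum_(0 <= i < N) ((K%:R ^- n) `^ s)%:E)).
  by apply: lee_sum => i _; exact: diam_pow_le.
rewrite sumEFin lee_fin big_mkord sumr_const card_ord -[leLHS]mulr_natl.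
rewrite ler_wpM2r ?powR_ge0//.
by rewrite /N card_tuple card_prod card_ord natrX natrM exprMn expr2.
Qed.

Lemma Hausdorff_premeasure2_le1 (A : set (X * X)) (d : R) : (0 < d)%R ->
  Hausdorff_premeasure 2 d A <= 1.
Proof.
move=> d0; near \oo => n.
apply: le_trans (@Hausdorff_premeasure_le A 2 d n _ _) _ => //.
  by near: n; exact: near_expn_lt.
rewrite powR_mulrn ?invr_ge0 ?exprn_ge0 ?(ltW K_gt0)// lee_fin exprVn divff//.
by rewrite !expf_neq0// gt_eqF.
Unshelve. all: by end_near. Qed.

(** The cylinders of level [n] give the bound K^(-n(s-2)), which tends to 0. *)
Lemma Hausdorff_premeasure_eq0 (A : set (X * X)) (s d : R) : (2 < s)%R ->
  (0 < d)%R -> Hausdorff_premeasure s d A = 0.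
Proof.
move=> s2 d0; apply/eqP; rewrite eq_le; apply/andP; split; last first.
  apply: le_ereal_inf_tmp => _ [C _ <-].
  by apply: nneseries_ge0 => *; exact: diam_pow_ge0.
apply/lee_addgt0Pr => e e0; rewrite add0e.
have s20 : (0 < s - 2)%R by rewrite subr_gt0.
near \oo => n.
apply: le_trans (@Hausdorff_premeasure_le A s d n _ _) _.
- by rewrite ltW// (lt_trans _ s2).
- by near: n; exact: near_expn_lt.
have x0 : (0 < K%:R ^- n :> R)%R by rewrite invr_gt0 exprn_gt0.
have -> : s = (2 + (s - 2))%R by rewrite addrC subrK.
rewrite lee_fin powRD ?(gt_eqF x0) ?implybT// powR_mulrn ?(ltW x0)//.
rewrite mulrA exprVn divff ?mul1r; last by rewrite !expf_neq0// gt_eqF.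
(* With [e] written as a power of exponent [s - 2], it remains to have K^-n below its base, which
   holds for large [n]. *)
have -> : e = ((e `^ (s - 2)^-1) `^ (s - 2))%R.
  by rewrite -powRrM mulVf ?gt_eqF// powRr1// ltW.
apply/ltW/gt0_ltr_powR => //; rewrite ?nnegrE ?powR_ge0 ?(ltW x0)//.
by near: n; apply: near_expn_lt; rewrite powR_gt0.
Unshelve. all: by end_near. Qed.

(** Diameters being at most 1, lowering the exponent from 2 to [s] can only increase the sums
    bounded in [sum_diam_pow_ge1]. *)
Lemma Hausdorff_premeasure_Li_Yorke_ge1 (s d : R) : (0 <= s <= 2)%R ->
  1 <= Hausdorff_premeasure s d (Li_Yorke_pairs (@shift_map R K)).
Proof.
move=> /andP[s0 s2]; apply: le_ereal_inf_tmp => _ [C [LYC _] <-].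
apply: le_trans (sum_diam_pow_ge1 LYC) _.
apply: lee_nneseries => [*|i _]; first exact: diam_pow_ge0.
exact: diam_pow_antitone.
Qed.

End full_shift_theory.

Theorem corollary1p2 (R : realType) (K : nat) (hK : (2 <= K)%N) :
  Hausdorff_dim (Li_Yorke_pairs (@shift_map R K)) = 2%:E%E /\
  Hausdorff_measure 2%R (Li_Yorke_pairs (@shift_map R K)) = 1%E.
Proof.
split; last first.
  apply: Hausdorff_measure_cst => d d0; apply/eqP; rewrite eq_le.
  rewrite Hausdorff_premeasure2_le1//= Hausdorff_premeasure_Li_Yorke_ge1//.
  by rewrite lexx ler0n.
apply/eqP; rewrite eq_le; apply/andP; split.
  (* Every exponent [2 + e] has measure 0, so the dimension is at most 2. *)
  apply/lee_addgt0Pr => e e0; apply: ereal_inf_lbound.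
  exists (2 + e); last by [].
  split; first by rewrite addr_ge0// ltW.
  by apply: Hausdorff_measure_cst => d; apply: Hausdorff_premeasure_eq0;
    rewrite // ltrDl.
(* Conversely, an exponent below 2 has measure at least 1, hence not 0. *)
apply: le_ereal_inf_tmp => _ [s [s0 Hs] <-]; rewrite lee_fin leNgt.
apply/negP => s2; suff : (1 <= 0 :> \bar R)%E by rewrite lee_fin ler10.
rewrite -Hs; apply: Hausdorff_measure_ge => d _.
by apply: Hausdorff_premeasure_Li_Yorke_ge1; rewrite // s0 ltW.
Qed.
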